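(* There is an absolute constant $C>0$ such that for every odd prime $p$ there exists a transversal of $B_p$, different from the main diagonal $\{(i,i,2i): i\in\mathbb{Z}_p\}$, containing at most $C\log p$ triples $(r,c,s)$ with $r\neq c$.
   Context: $B_p$ is the Latin square of order $p$ viewed as the set of triples $\{(i,j,i+j \bmod p): i,j\in\mathbb{Z}_p\}$ (row, column, symbol). A transversal of a Latin square of order $p$ is a set of $p$ of its triples that contains each row, each column and each symbol exactly once. The main diagonal consists of the cells $(i,i)$. *)

(* Defs.v *)
From Stdlib Require Import Reals.
From mathcomp Require Import all_boot.
Set Implicit Arguments. Unset Strict Implicit. Unset Printing Implicit Defensive.

Definition triple (p : nat) := ('I_p * 'I_p * 'I_p)%type.

Definition t_row (p : nat) (t : triple p) : 'I_p := t.1.1.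
Definition t_col (p : nat) (t : triple p) : 'I_p := t.1.2.
Definition t_sym (p : nat) (t : triple p) : 'I_p := t.2.

Definition Bp (p : nat) : {set triple p} :=
  [set t : triple p | val (t_sym t) == (val (t_row t) + val (t_col t)) %% p].

Definition is_transversal_Bp (p : nat) (T : {set triple p}) : Prop :=
  [/\ T \subset Bp p, #|T| = p,
      forall r : 'I_p, #|[set t in T | t_row t == r]| = 1,
      forall c : 'I_p, #|[set t in T | t_col t == c]| = 1
    & forall s : 'I_p, #|[set t in T | t_sym t == s]| = 1].

Definition main_diagonal (p : nat) : {set triple p} :=
  [set t in Bp p | t_row t == t_col t].

Definition off_diag_count (p : nat) (T : {set triple p}) : nat :=
  #|[set t in T | t_row t != t_col t]|.

(* Main.v *)
(* Cut an a x b rectangle into squares and project the plane on Z by (x, y) |-> x + y.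
   A square of side d with lower-left corner sent to l contributes
   [l] + [l + 2d] - 2 [l + d], and the signed corner sums of the squares add up to
   those of the rectangle, [0] + [a + b] - [a] - [b], which vanishes mod p when a = p.
   So if the midpoints v = l + d are distinct mod p, every v occurs exactly twice among
   the l and l + 2d; orienting the pairs {l, l + 2d} along the cycles they form makes
   the rows, the columns and the half-symbols of the cells (l, l + 2d) permutations of
   the v's, and these cells can replace the diagonal cells (v, v).
   It remains to cut a p x b rectangle into O(log p) squares with distinct midpoints.
   Peeling at most six squares turns a (c - 1) x (c + 1) rectangle into a smaller one
   of the same kind in a unit 2h times larger, with c' about c / 4h; the midpoints
   stay distinct because those of later squares are smaller. Since p is not divisible
   by 3, p = 3b +- 2, and two squares of side b reduce p x b to such a rectangle. *)

Require Import Defs.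
From Stdlib Require Import Reals.
From mathcomp Require Import all_boot.
From mathcomp Require Import zmodp zify.
From Stdlib Require Import Lra.

(** * Square tilings of rectangles, projected to the line *)

(* A square is encoded by (l, d): d is its side, l the coordinate sum of its lower-left
   corner. *)
Definition lo (q : nat * nat) := q.1.
Definition mid (q : nat * nat) := q.1 + q.2.
Definition hi (q : nat * nat) := q.1 + q.2 + q.2.

(** Only the projected trace of a tiling is recorded: the signed corner identity, with negative
    terms moved across to give an equality of multisets. *)
Definition tiles (a b : nat) (s : seq (nat * nat)) : bool :=
  perm_eq (map lo s ++ map hi s ++ [:: a; b])
          (map mid s ++ map mid s ++ [:: 0; a + b]).

Lemma tilesP a b s :
  reflect (forall P : pred nat,
             count P (map lo s) + count P (map hi s) + P a + P b =
             2 * count P (map mid s) + P 0 + P (a + b))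
          (tiles a b s).
Proof.
apply: (iffP permP) => H P; move/(_ P): H; rewrite !count_cat /= !addn0; lia.
Qed.

Lemma tiles_sym a b s : tiles a b s -> tiles b a s.
Proof. by move/tilesP=> H; apply/tilesP=> P; move/(_ P): H; rewrite (addnC b a); lia. Qed.

(** The new square is glued along the side [b], with lower-left corner at ([a], 0). *)
Lemma tiles_cons a b s : tiles a b s -> tiles (a + b) b ((a, b) :: s).
Proof.
move=> /tilesP H; apply/tilesP=> P; move/(_ P): H.
rewrite /= /lo /mid /hi /=; lia.
Qed.

Definition scale k (q : nat * nat) := (k * q.1, k * q.2).

Lemma tiles_scale k a b s :
  tiles a b s -> tiles (k * a) (k * b) (map (scale k) s).
Proof.
have El : lo \o scale k =1 muln k \o lo by [].
have Em : mid \o scale k =1 muln k \o mid by move=> q; rewrite /mid /= mulnDr.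
have Eh : hi \o scale k =1 muln k \o hi by move=> q; rewrite /hi /= !mulnDr.
move=> /(perm_map (muln k)); rewrite /tiles !map_cat -!map_comp /= muln0 mulnDr.
by rewrite (eq_map El) (eq_map Em) (eq_map Eh).
Qed.

(** Euclid's algorithm: the midpoint of each removed square is the longer side, which exceeds all
    later midpoints. The count is linear, enough for bounded sides. *)
Lemma euclid_tiling a b : exists s : seq (nat * nat),
  [/\ tiles a b s, uniq (map mid s),
      all (fun q => (0 < mid q <= maxn a b) && (0 < q.2 <= minn a b)) s
    & size s <= a + b].
Proof.
have [n] := ubnP (a + b); elim: n a b => // n IH a b.
wlog le_ba : a b / b <= a.
  move=> W; case/orP: (leq_total b a) => le_ab Hn; first exact: W.
  have [|s [/tiles_sym Hs Us As Ss]] := W b a le_ab; first by rewrite addnC.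
  by exists s; rewrite maxnC minnC addnC.
case: b le_ba => [|b] le_ba Hn.
  by exists [::]; split=> //; apply/tilesP=> P /=; rewrite (addn0 a); lia.
case: (eqVneq a b.+1) => [->|neq_ab].
  exists [:: (0, b.+1)]; split => //; last by rewrite /= /mid /=; lia.
  by apply/tilesP=> P; rewrite /= /lo /mid /hi /= !add0n; lia.
have [|s [Hs Us /allP As Ss]] := IH (a - b.+1) b.+1; first lia.
exists ((a - b.+1, b.+1) :: s); split => /=; last lia.
- by rewrite -{1}(subnK le_ba); apply: tiles_cons.
- rewrite Us andbT; apply/negP => /mapP[q /As]; rewrite /mid /=; lia.
- apply/andP; split; first by rewrite /mid /=; lia.
  by apply/allP => q /As; move: (mid q) q.2; lia.
Qed.

(** * Peeling and the logarithmic tiling *)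

(** The upper corners of the three squares are [a + b] and, twice, the first midpoint [m + x]; [a']
    and [b'] are corners of the small rectangle. These all cancel, and [E] balances the rest. *)
Lemma tiles_peel a b a' b' m x y z E s :
  tiles a' b' s ->
  m + x + x = a + b -> a' + y + y = m + x -> b' + z + z = m + x ->
  (forall P : pred nat,
     count P (map lo E) + count P (map hi E) + P m + P (a' + b') + P a + P b =
     2 * (count P (map mid E) + P (a' + y) + P (b' + z))) ->
  tiles a b ((m, x) :: (a', y) :: (b', z) :: E ++ s).
Proof.
move=> /tilesP Hs Ex Ey Ez HE; apply/tilesP => P; move: (Hs P) (HE P).
rewrite /= !map_cat !count_cat /lo /mid /hi /= Ex Ey Ez.
by repeat match goal with |- context [nat_of_bool ?b] =>
  move: (nat_of_bool b) => ? end; lia.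
Qed.

(* With h = 1, c = 4 c' + d for d in {0, 1, -1} unless c = 2 mod 4, and in that case
   h = 2, c = 8 c' + d for d = 2 or -2. The three large squares have midpoints near
   3c/2, c - h and c + h; E consists of unit squares. *)
Lemma tiling_step c : 64 <= c -> exists c' h E x y z m,
  [/\ 5 <= c' <= c./2, 0 < h <= 2, size E <= 3,
      forall s, tiles (c' - 1) (c' + 1) s ->
        tiles (c - 1) (c + 1)
          ((m, x) :: (2 * h * (c' - 1), y) :: (2 * h * (c' + 1), z) ::
            E ++ map (scale (2 * h)) s)
    & let V := map mid ((m, x) :: (2 * h * (c' - 1), y) ::
                         (2 * h * (c' + 1), z) :: E) in
      uniq V && all (fun v => (h * (3 * c' + 2) < v) && (2 * v <= 3 * c + 2)) V].
Proof.
move=> c_ge.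
have [k Ek] : exists k, c = 4 * k \/ c = 4 * k + 1 \/ c + 1 = 4 * k \/
                          c = 8 * k + 2 \/ c + 2 = 8 * k.
  have := divn_eq c 8; have := @ltn_pmod c 8 isT.
  move: (c %% 8) (c %/ 8) => r q.
  case: r => [|[|[|[|[|[|[|[|r]]]]]]]] // _ Ec;
    [exists (2 * q) | exists (2 * q) | exists q | exists (2 * q + 1)
    |exists (2 * q + 1)|exists (2 * q + 1)|exists (q + 1)|exists (2 * q + 2)];
    lia.
(* The offset d above is shifted by 2 here, to stay in nat. *)
have peel h d m E x y z :
    m = c + d - 2 -> c + 2 = 4 * h * k + d -> 0 < h <= 2 -> d <= 4 ->
    x = 2 * h * k -> y + 2 = d + 2 * h * k + h -> z + h + 2 = 2 * h * k + d ->
    (forall P : pred nat,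
       count P (map lo E) + count P (map hi E) + P (c + d - 2) + P (c + 2 - d)
         + P (c - 1) + P (c + 1) =
       2 * (count P (map mid E) + P (c - h) + P (c + h))) ->
    forall s, tiles (k - 1) (k + 1) s ->
        tiles (c - 1) (c + 1)
          ((m, x) :: (2 * h * (k - 1), y) :: (2 * h * (k + 1), z) ::
            E ++ map (scale (2 * h)) s).
  move=> Em Ec h12 d_le Ex Ey Ez HE s /(tiles_scale (2 * h)) Hs.
  have {}h12 : h = 1 \/ h = 2 by lia.
  apply: tiles_peel => //.
  - case: h12 => Eh; subst h; lia.
  - case: h12 => Eh; subst h; lia.
  - case: h12 => Eh; subst h; lia.
  have -> : 2 * h * (k - 1) + y = c - h by case: h12 => Eh; subst h; lia.
  have -> : 2 * h * (k + 1) + z = c + h by case: h12 => Eh; subst h; lia.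
  have -> : 2 * h * (k - 1) + 2 * h * (k + 1) = c + 2 - d by case: h12 => Eh; subst h; lia.
  by rewrite Em.
case: Ek => [Ec|[Ec|[Ec|[Ec|Ec]]]].
- exists k, 1, [:: (c - 1, 1)], (2 * k), (2 * k + 1), (2 * k - 1), c.
  split=> //; first lia; last by clear peel; rewrite /mid /= !inE; lia.
  apply: (peel 1 2) => //; try lia.
  move=> P; rewrite /lo /hi /mid /=.
  by rewrite addnK subnK ?addnK; lia.
- exists k, 1, [::], (2 * k), (2 * k + 2), (2 * k), (c + 1).
  split=> //; first lia; last by clear peel; rewrite /mid /= !inE; lia.
  apply: (peel 1 3) => //; try lia.
  move=> P /=; have -> : c + 3 - 2 = c + 1 by lia.
  have -> : c + 2 - 3 = c - 1 by lia.
  by lia.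
- exists k, 1, [::], (2 * k), (2 * k), (2 * k - 2), (c - 1).
  split=> //; first lia; last by clear peel; rewrite /mid /= !inE; lia.
  apply: (peel 1 1) => //; try lia.
  move=> P /=; have -> : c + 1 - 2 = c - 1 by lia.
  have -> : c + 2 - 1 = c + 1 by lia.
  by lia.
(* With these unit squares, each of [c - 2], ..., [c + 2] occurs twice on both sides of the
   balance. *)
- exists k, 2, [:: (c - 2, 1); (c - 1, 1); (c, 1)],
    (4 * k), (4 * k + 4), (4 * k), (c + 2).
  split=> //; first lia; last by clear peel; rewrite /mid /= !inE; lia.
  apply: (peel 2 4) => //; try lia.
  move=> P; rewrite /lo /hi /mid /=.
  have -> : c + 4 - 2 = c + 2 by lia.
  have -> : c + 2 - 4 = c - 2 by lia.
  have -> : c - 2 + 1 = c - 1 by lia.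
  rewrite subnK; last lia.
  have -> : c + 1 + 1 = c + 2 by lia.
  by lia.
- exists k, 2, [:: (c - 2, 1); (c - 1, 1); (c, 1)],
    (4 * k), (4 * k), (4 * k - 4), (c - 2).
  split=> //; first lia; last by clear peel; rewrite /mid /= !inE; lia.
  apply: (peel 2 0) => //; try lia.
  move=> P; rewrite /lo /hi /mid /=.
  have -> : c + 0 - 2 = c - 2 by lia.
  have -> : c + 2 - 0 = c + 2 by lia.
  have -> : c - 2 + 1 = c - 1 by lia.
  rewrite subnK; last lia.
  have -> : c + 1 + 1 = c + 2 by lia.
  by lia.
Qed.

(** As [c'] is at most half of [c], at most [n] steps of at most six squares reach [c < 64], where
    Euclid applies. The bound [3 * c + 2], once scaled, keeps later midpoints below the peeled
    ones. *)
Lemma near_square_tiling n c : 2 <= c -> c < 64 * 2 ^ n ->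
  exists s : seq (nat * nat),
  [/\ tiles (c - 1) (c + 1) s, uniq (map mid s),
      all (fun q => 0 < mid q) s, all (fun q => 2 * mid q <= 3 * c + 2) s
    & size s <= 128 + 6 * n].
Proof.
elim: n c => [|n IH] c c_ge2 c_lt.
  have [s [Hs Us /allP As Ss]] := euclid_tiling (c - 1) (c + 1).
  exists s; split=> //; try (apply/allP => q /As; move: (mid q) q.2; lia).
  by move: c_lt; rewrite expn0; lia.
have [c_lt64|c_ge64] := ltnP c 64.
  have [|s [? ? ? ? ?]] := IH c c_ge2; first by have := expn_gt0 2 n; nia.
  by exists s; split=> //; lia.
have [c' [h [E [x [y [z [m [c'P hP sE tE]]]]]]]] := tiling_step c c_ge64.
move=> /andP[UV /allP AV].
have [| |s [Hs Us /allP Ps /allP Bs Ss]] := IH c'; first lia.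
  by move: c_lt; rewrite expnS; lia.
set W := (m, x) :: (2 * h * (c' - 1), y) :: (2 * h * (c' + 1), z) :: E in UV AV.
have Emid q : mid (scale (2 * h) q) = 2 * h * mid q by rewrite /mid /= mulnDr.
have AW q : q \in W -> (h * (3 * c' + 2) < mid q) && (2 * mid q <= 3 * c + 2).
  by move=> qW; apply: AV; apply: map_f.
have AS q : q \in s -> [&& 0 < 2 * h * mid q, 2 * h * mid q <= h * (3 * c' + 2)
    & 2 * (2 * h * mid q) <= 3 * c + 2].
  move=> qs; have := AW (m, x) (mem_head _ _).
  move: (Ps q qs) (Bs q qs) hP; move: (mid (m, x)) => v /=; move: (mid q) => u; clear.
  by case: h => [|[|[|h]]] //; lia.
exists (W ++ map (scale (2 * h)) s); split.
- exact: tE.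
- rewrite map_cat cat_uniq UV andTb; apply/andP; split.
    apply/hasPn => _ /mapP[_ /mapP[q /AS qP ->] ->]; apply/negP.
    by case/mapP => q' /AW q'P E'; move: qP q'P; rewrite -E' Emid; lia.
  rewrite -map_comp (eq_map Emid) map_comp map_inj_uniq // => u v /eqP.
  by rewrite eqn_pmul2l ?muln_gt0; [move/eqP | lia].
- rewrite all_cat; apply/andP; split; first by apply/allP => q /AW; lia.
  by rewrite all_map; apply/allP => q /AS /=; rewrite Emid; lia.
- rewrite all_cat; apply/andP; split; first by apply/allP => q /AW; lia.
  by rewrite all_map; apply/allP => q /AS /=; rewrite Emid; lia.
- by rewrite size_cat size_map /=; lia.
Qed.

(** * Balanced orientation of a multigraph with even degrees *)

Lemma count_unzip_rem (T : eqType) (s : seq (T * T)) q (P : pred T) :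
  q \in s ->
  count P (unzip1 s) = P q.1 + count P (unzip1 (rem q s)) /\
  count P (unzip2 s) = P q.2 + count P (unzip2 (rem q s)).
Proof.
move=> /perm_to_rem qs.
by split; [move/(perm_map fst)/permP: qs | move/(perm_map snd)/permP: qs]; apply.
Qed.

(* Symmetric functions g express that t is s up to reordering and flipping pairs. The
   induction contracts two consecutive edges x - y - z into x - z. *)
Lemma orientation (T : eqType) (s : seq (T * T)) :
  (forall x, ~~ odd (count_mem x (unzip1 s ++ unzip2 s))) ->
  exists t : seq (T * T), perm_eq (unzip1 t) (unzip2 t) /\
    forall (U : eqType) (g : T * T -> U),
      (forall x y, g (x, y) = g (y, x)) -> perm_eq (map g s) (map g t).
Proof.
have [n] := ubnP (size s); elim: n s => // n IH [|[x y] s] /=.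
  by move=> _ _; exists [::].
rewrite ltnS => s_lt evs.
have [Exy|neq_xy] := eqVneq x y.
  rewrite -{y}Exy in evs *.
  have [//||t [Ht gt]] := IH s.
    by move=> w; move: (evs w); rewrite !count_cat /=; lia.
  exists ((x, x) :: t); split=> [|U g gC] /=; rewrite perm_cons //; exact: gt.
(* [y] has even degree and differs from [x], so another pair meets it. *)
have [z [q [qs Eq]]] : exists z q, q \in s /\ (q = (y, z) \/ q = (z, y)).
  have : y \in unzip1 s ++ unzip2 s.
    rewrite -has_pred1 has_count; move: (evs y).
    by rewrite !count_cat /= eqxx (negPf neq_xy); lia.
  rewrite mem_cat => /orP[] /mapP[[u v] uvs /= Ey]; rewrite -{}Ey in uvs.
    by exists v, (y, v); split; [|left].
  by exists u, (u, y); split; [|right].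
have pqs := perm_to_rem qs; set s' := rem q s in pqs.
have cq (P : pred T) : count P (unzip1 s) + count P (unzip2 s) =
    P y + P z + count P (unzip1 s') + count P (unzip2 s').
  have [-> ->] := count_unzip_rem _ _ _ P qs.
  by rewrite -/s'; case: Eq => -> /=; lia.
have [||t' [Ht' gt']] := IH ((x, z) :: s').
- by have := perm_size pqs => /=; lia.
- move=> w; move: (evs w) (cq (pred1 w)); rewrite /= !count_cat /=.
  by repeat match goal with |- context [nat_of_bool ?b] =>
    move: (nat_of_bool b) => ? end; lia.
have step r : (r = (x, z) \/ r = (z, x)) -> r \in t' ->
    forall (U : eqType) (g : T * T -> U), (forall x y, g (x, y) = g (y, x)) ->
    perm_eq (g (x, y) :: map g s) (g (x, y) :: g (y, z) :: map g (rem r t')).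
  move=> Er rt' U g gC; rewrite perm_cons.
  apply: perm_trans (perm_map g pqs) _ => /=.
  have -> : g q = g (y, z) by case: Eq => ->.
  rewrite perm_cons.
  have := perm_trans (gt' U g gC) (perm_map g (perm_to_rem rt')).
  have /= -> : g r = g (x, z) by case: Er => ->.
  by rewrite perm_cons.
(* A symmetric test detects the contracted pair in [t'], in one of its two directions. *)
have [xzt|zxt] : (x, z) \in t' \/ (z, x) \in t'.
  pose g (q : T * T) := (q == (x, z)) || (q == (z, x)).
  have gC u v : g (u, v) = g (v, u) by rewrite /g !xpair_eqE orbC andbC (andbC (u == x)).
  have : true \in map g t' by rewrite -(perm_mem (gt' _ g gC)) /= /g eqxx mem_head.
  by case/mapP => r rt' /esym /orP[] /eqP Er; rewrite Er in rt'; [left | right].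
(* Reinserting [y] makes it once a first and once a second entry, so balance persists. *)
- exists ((x, y) :: (y, z) :: rem (x, z) t'); split; last first.
    by apply: step => //; left.
  apply/permP => P; move/permP/(_ P): Ht'.
  have [-> ->] := count_unzip_rem _ _ _ P xzt.
  by rewrite /=; lia.
- exists ((y, x) :: (z, y) :: rem (z, x) t'); split; last first.
    move=> U g gC /=; rewrite (gC y x) (gC z y).
    by apply: step => //; right.
  apply/permP => P; move/permP/(_ P): Ht'.
  have [-> ->] := count_unzip_rem _ _ _ P zxt.
  by rewrite /=; lia.
Qed.

(** * From tilings to transversals *)

Lemma card_fiber_uniq (X Y : finType) (f : X -> Y) (L : seq X) y :
  perm_eq (map f L) (enum Y) -> #|[set t in [set x in L] | f t == y]| = 1.
Proof.
move=> fL; have uL : uniq L by apply: (@map_uniq _ _ f); rewrite (perm_uniq fL) enum_uniq.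
have -> : [set t in [set x in L] | f t == y] = [set t in filter (preim f (pred1 y)) L].
  by apply/setP => t; rewrite !inE mem_filter andbC.
rewrite cardsE (card_uniqP (filter_uniq _ uL)) size_filter -count_map.
by rewrite (permP fL) count_uniq_mem ?enum_uniq // mem_enum.
Qed.

Lemma transversal_of_seq p (L : seq (triple p)) :
  {subset L <= Bp p} -> perm_eq (map (@t_row p) L) (enum 'I_p) ->
  perm_eq (map (@t_col p) L) (enum 'I_p) ->
  perm_eq (map (@t_sym p) L) (enum 'I_p) -> is_transversal_Bp [set t in L].
Proof.
move=> LB rL cL sL; split; try by move=> ?; apply: card_fiber_uniq.
  by apply/subsetP => t; rewrite inE => /LB.
have uL : uniq L by apply: (@map_uniq _ _ (@t_row p)); rewrite (perm_uniq rL) enum_uniq.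
have -> : #|[set t in L]| = size L by rewrite cardsE; apply/card_uniqP.
by rewrite -(size_map (@t_row p)) (perm_size rL) -cardE card_ord.
Qed.

Lemma prime_gt3_mod3 p : prime p -> 3 < p -> exists b, p = 3 * b + 2 \/ p + 2 = 3 * b.
Proof.
move=> pr p3; have ndv : ~~ (3 %| p).
  by rewrite dvdn_prime2 //; lia.
have [E|E] : p %% 3 = 1 \/ p %% 3 = 2 by lia.
  by exists ((p + 2) %/ 3); lia.
by exists (p %/ 3); lia.
Qed.

(** Midpoints in (0, [p]] stay distinct mod [p], oddness makes doubling a permutation, and a side
    strictly between 0 and [p] gives an off-diagonal cell. *)
Lemma transversal_of_tiling p b (s : seq (nat * nat)) :
  odd p -> tiles p b s -> uniq (map mid s) ->
  all (fun q => 0 < mid q <= p) s -> has (fun q => 0 < q.2 < p) s ->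
  exists T : {set triple p}, is_transversal_Bp T /\ T <> main_diagonal p /\
    off_diag_count T <= size s.
Proof.
case: p => // n oddp; set p := n.+1.
move=> /(perm_map (@inZp n)) Hs Us /allP Ps /hasP[q0 q0s q0P].
pose add (q : 'I_p * 'I_p) : 'I_p := inZp (q.1 + q.2).
pose dbl (x : 'I_p) : 'I_p := inZp (x + x).
have eq_inZp x y : (inZp x == inZp y :> 'I_p) = (x == y %[mod p]) by [].
have dbl_dvd k : (p %| k + k) = (p %| k).
  by rewrite addnn -mul2n Gauss_dvdr // coprime_sym coprime2n.
have dblI : injective dbl.
  move=> x y /eqP; rewrite eq_inZp.
  wlog le_yx : x y / y <= x => [W|].
    by case/orP: (leq_total y x) => /W // + E => /(_ _)->; rewrite // eq_sym.
  rewrite eqn_mod_dvd ?leq_add // => dv.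
  have {dv} : p %| (x - y) + (x - y) by rewrite (_ : _ + _ = x + x - (y + y)) //; lia.
  rewrite dbl_dvd => dv; apply/val_inj/eqP; rewrite eqn_leq le_yx andbT -subn_eq0.
  by rewrite -(modn_small (leq_ltn_trans (leq_subr y x) (ltn_ord x))).
pose V := [seq inZp (mid q) : 'I_p | q <- s].
have uV : uniq V.
  rewrite /V (map_comp (@inZp n) mid) map_inj_in_uniq // => u v.
  move=> /mapP[q /Ps qP ->] /mapP[r /Ps rP ->] /eqP; rewrite eq_inZp.
  move: (mid q) (mid r) qP rP => {}u {}v uP vP.
  wlog le_vu : u v uP vP / v <= u => [W|].
    by case/orP: (leq_total v u) => /W // + E => /(_ _ _ _)->; rewrite // eq_sym.
  rewrite eqn_mod_dvd // => dv; apply/eqP; rewrite eqn_leq le_vu andbT -subn_eq0.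
  by rewrite -(modn_small (_ : u - v < p)) //; lia.
pose pairs := [seq (inZp (lo q) : 'I_p, inZp (hi q) : 'I_p) | q <- s].
have count_pairs (P : pred 'I_p) :
    count P (unzip1 pairs) + count P (unzip2 pairs) = 2 * count P V.
  move/permP/(_ P): Hs; rewrite !map_cat !count_cat -!map_comp /=.
  (* Mod [p], the corners [p] and [p + b] merge with 0 and [b], and cancel. *)
  have -> : inZp p = inZp 0 :> 'I_p by apply/eqP; rewrite eq_inZp modnn mod0n.
  have -> : inZp (p + b) = inZp b :> 'I_p by apply/eqP; rewrite eq_inZp modnDl.
  rewrite /unzip1 /unzip2 /pairs /V -!map_comp /comp /=.
  by rewrite !addnA => /addIn/addIn/addIn->; rewrite mul2n addnn.
have [x|t [Ht gt]] := orientation _ pairs.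
  by rewrite count_cat count_pairs; lia.
have count_t (P : pred 'I_p) :
    count P (unzip1 t) + count P (unzip2 t) = 2 * count P V.
  rewrite -count_pairs.
  have sum_count r : sumn [seq P q.1 + P q.2 | q : 'I_p * 'I_p <- r] =
      count P (unzip1 r) + count P (unzip2 r).
    by elim: r => //= q r ->; lia.
  rewrite -!sum_count; apply/esym/perm_sumn/(gt _ (fun q => P q.1 + P q.2)) => x y.
  exact: addnC.
have tV : perm_eq (unzip1 t) V.
  apply/permP => P; move: (count_t P); rewrite -(permP Ht) addnn -mul2n => /eqP.
  by rewrite eqn_pmul2l // => /eqP.
have addt : perm_eq (map add t) (map dbl V).
  have addC x y : add (x, y) = add (y, x) by rewrite /add /= addnC.
  rewrite perm_sym (perm_trans _ (gt _ add addC)) // /pairs /V -!map_comp.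
  rewrite (eq_map (g := add \o fun q => (inZp (lo q) : 'I_p, inZp (hi q) : 'I_p))) // => q /=.
  apply/eqP; rewrite /dbl /add eq_inZp /= !modnDm /lo /hi /mid.
  by rewrite (_ : _ + _ = q.1 + (q.1 + q.2 + q.2)) //; lia.
(* Rows outside [V] keep their diagonal cells. *)
pose W := [seq x <- enum 'I_p | x \notin V].
have VW : perm_eq (V ++ W) (enum 'I_p).
  apply: uniq_perm; rewrite ?enum_uniq //.
    rewrite cat_uniq uV filter_uniq ?enum_uniq // andbT.
    by apply/hasPn => x; rewrite mem_filter => /andP[].
  by move=> x; rewrite mem_cat mem_filter mem_enum andbT orbN.
have dbl_enum : perm_eq (map dbl (enum 'I_p)) (enum 'I_p).
  apply: uniq_perm => [||y]; rewrite ?(map_inj_uniq dblI) ?enum_uniq //.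
  by rewrite mem_enum; apply: (injF_onto dblI).
pose mk (q : 'I_p * 'I_p) : triple p := (q.1, q.2, add q).
pose L := map mk t ++ [seq mk (x, x) | x <- W].
exists [set t in L]; split; last split.
- apply: transversal_of_seq.
  + move=> _ /[!mem_cat] /orP[] /mapP[q _ ->]; rewrite inE; exact: eqxx.
  + rewrite map_cat -!map_comp; apply: perm_trans VW.
    by rewrite [X in _ ++ X]map_id perm_cat2r.
  + rewrite map_cat -!map_comp; apply: perm_trans VW.
    rewrite [X in _ ++ X]map_id perm_cat2r.
    by apply: perm_trans tV; rewrite perm_sym.
  + rewrite map_cat -!map_comp; apply: perm_trans dbl_enum.
    apply: perm_trans (perm_map dbl VW); rewrite map_cat perm_cat2r.
    exact: addt.
- have gC (x y : 'I_p) : (x == y) = (y == x) by apply: eq_sym.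
  (* For [q0], [hi - lo] is twice the side, nonzero mod the odd [p]. *)
  have : false \in [seq q.1 == q.2 | q <- t].
    rewrite -(perm_mem (gt _ (fun q => q.1 == q.2) gC)).
    apply/mapP; exists (inZp (lo q0), inZp (hi q0)); first exact: map_f.
    apply/esym/negbTE; rewrite /= eq_inZp /lo /hi -addnA -{1}[q0.1]addn0 eqn_modDl.
    by rewrite mod0n eq_sym -/(dvdn p _) dbl_dvd gtnNdvd //; lia.
  case/mapP => q qt neq E; have : mk q \in main_diagonal p.
    by rewrite -E inE mem_cat map_f.
  by rewrite !inE => /andP[_]; rewrite /t_row /t_col /= -neq.
- rewrite /off_diag_count.
  have -> : size s = size (map mk t).
    by rewrite size_map -(size_map fst t) (perm_size tV) size_map.
  apply: leq_trans (card_size _); apply: subset_leq_card.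
  apply/subsetP => x; rewrite !inE mem_cat => /andP[/orP[//|/mapP[y _ ->]]].
  by rewrite eqxx.
Qed.

(** * A tiling for each odd prime and the final bound *)

Lemma prime_tiling p : prime p -> odd p ->
  exists b (s : seq (nat * nat)),
  [/\ tiles p b s, uniq (map mid s), all (fun q => 0 < mid q <= p) s,
      has (fun q => 0 < q.2 < p) s & size s <= 130 + 6 * trunc_log 2 p].
Proof.
move=> pr_p odd_p; have p_gt1 := prime_gt1 pr_p.
have [p_small|p_large] := ltnP p 64.
  have [s [Hs Us /allP As Ss]] := euclid_tiling p 1.
  exists 1, s; split=> //; last lia.
    by apply/allP => q /As; move: (mid q) q.2; lia.
  (* An empty tiling is impossible: the corner 1 would be unmatched. *)
  case: s => [|q s] in Hs Us As Ss *.
    by move/permP/(_ (pred1 1)): Hs => /=; rewrite !(gtn_eqF, addn1); lia.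
  by have := As q (mem_head _ _); rewrite /=; move: (mid q) q.2; lia.
have p_lt := trunc_log_ltn p (isT : 1 < 2); rewrite expnS in p_lt.
have [b Eb] := prime_gt3_mod3 p pr_p (leq_trans (isT : 3 < 64) p_large).
(* Here [a] is [b + 2] or [b - 2], and [c] is the mean of [a] and [b]. *)
have [a [c [Ea c_ge c_lt tac le_c]]] : exists a c,
    [/\ p = a + b + b, 2 <= c, c < 64 * 2 ^ trunc_log 2 p,
        forall s, tiles (c - 1) (c + 1) s -> tiles a b s & c <= b + 1].
  case: Eb => Eb.
    exists (b + 2), (b + 1); split; try lia.
    by move=> s /tiles_sym; rewrite addnK -addnA.
  exists (b - 2), (b - 1); split; try lia.
  by move=> s; rewrite -subnDA subnK //; lia.
have [s [/tac Hs Us /allP Ps /allP Bs Ss]] := near_square_tiling _ c c_ge c_lt.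
(* This separates later midpoints from [a + b] and [p], those of the two large squares. *)
have Bs' q : q \in s -> 0 < mid q < a + b.
  by move=> qs; move: (Ps q qs) (Bs q qs) => /=; move: (mid q); lia.
exists b, ((a + b, b) :: (a, b) :: s); split.
- by rewrite {1}Ea; do 2!apply: tiles_cons.
- have E1 : mid (a + b, b) = p by [].
  have E2 : mid (a, b) = a + b by [].
  rewrite /= E1 E2 Us andbT inE negb_or -andbA; apply/and3P; split; first lia.
    by apply/negP => /mapP[q /Bs' qP E]; move: qP; rewrite -E; lia.
  by apply/negP => /mapP[q /Bs' qP E]; move: qP; rewrite -E; lia.
- apply/allP => q; rewrite !inE => /or3P[/eqP->|/eqP->|/Bs'].
  + by rewrite /mid /=; lia.
  + by rewrite /mid /=; lia.
  + by move: (mid q); lia.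
- by rewrite /=; lia.
- by rewrite /=; lia.
Qed.

Lemma ln_le x y : Rlt 0 x -> Rle x y -> Rle (ln x) (ln y).
Proof.
move=> x_gt0 [lt_xy|->]; last exact: Rle_refl.
by apply/Rlt_le/ln_increasing.
Qed.

Lemma trunc_log2_le_ln p : 0 < p -> Rle (INR (trunc_log 2 p)) (Rmult 2 (ln (INR p))).
Proof.
move=> p_gt0.
have le_p : Rle (pow 2 (trunc_log 2 p)) (INR p).
  have -> : pow 2 (trunc_log 2 p) = INR (2 ^ trunc_log 2 p).
    by elim: (trunc_log 2 p) => //= n ->; rewrite expnS mult_INR.
  by apply: le_INR; have := trunc_logP (isT : 1 < 2) p_gt0; lia.
have := ln_le _ _ (pow_lt 2 (trunc_log 2 p) Rlt_0_2) le_p.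
rewrite ln_pow; last exact: Rlt_0_2.
have := ln_lt_2; have := pos_INR (trunc_log 2 p); nra.
Qed.

Theorem theorem6p3 :
  exists C : R, Rlt 0 C /\
    forall p : nat, prime p -> odd p ->
      exists T : {set triple p},
        is_transversal_Bp T /\ T <> main_diagonal p /\
        Rle (INR (off_diag_count T)) (Rmult C (ln (INR p))).
Proof.
(* 272 = 2 * 130 + 2 * 6: [ln p >= ln 2 > 1/2] absorbs 130, and the base 2 logarithm is at most
   [2 * ln p]. *)
exists (IZR 272); split; first lra.
move=> p pr_p odd_p.
have [b [s [Hs Us Ps nts Ss]]] := prime_tiling p pr_p odd_p.
have [T [tT [ndT cT]]] := transversal_of_tiling p b s odd_p Hs Us Ps nts.
exists T; split=> //; split=> //.
have : Rle (INR (off_diag_count T)) (INR (130 + 6 * trunc_log 2 p)).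
  by apply: le_INR; lia.
rewrite plus_INR mult_INR.
have -> : INR 130 = IZR 130 by rewrite INR_IZR_INZ.
have -> : INR 6 = IZR 6 by rewrite INR_IZR_INZ.
have := trunc_log2_le_ln p (prime_gt0 pr_p).
have : Rle (ln 2) (ln (INR p)).
  apply: ln_le; first lra.
  by apply: (le_INR 2); have := prime_gt1 pr_p; lia.
by have := ln_lt_2; lra.
Qed.
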